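(* Let $I$ be a non-principal monomial ideal in $\mathsf{k}[x,y]$ and let $P$ be a set with $P(I)\subseteq P\subseteq P^{\ast}(I)$, $P=\{g_1,\dots,g_{k+1}\}$, where $g_1,\dots,g_{k+1}$ are ordered in descending $y$-degree. Further, let $D\ge(\mu(I)-|P|)\cdot\delta_P+|P|\cdot d_P$ be an integer. Then for all integers $\ell\ge0$, $$I^{D+\ell}=\sum_{i=1}^{k}(g_i,g_{i+1})^{\ell}I^D .$$
   Context: $\mathsf{k}$ is a field, $\mathbb{N}=\{1,2,\dots\}$. For a nonzero monomial ideal $I\subseteq\mathsf{k}[x,y]$: $\mathsf{G}(I)$ is its minimal set of monomial generators, $\mu(I)=|\mathsf{G}(I)|$, and $\gcd(I)$ is the greatest common divisor of all monomials in $I$. For $\bullet\in\{x,y\}$, $\operatorname{dist}_\bullet(I):=\max\{\deg_\bullet g\mid g\in\mathsf{G}(I:\gcd(I))\}$; for monomials $g,h$, $\operatorname{dist}_\bullet(g,h)$ is $\operatorname{dist}_\bullet$ of the ideal $(g,h)$. The integral closure $\overline{I}$ is the monomial ideal whose monomials are those $f$ with $f^n\in I^n$ for some $n\in\mathbb{N}$. A generator $f\in\mathsf{G}(I)$ is persistent if $f\notin\overline{(g,h)}$ for all monomials $g,h\in I\setminus\{f\}$; $P(I)$ is the set of persistent generators. $f\in\mathsf{G}(I)$ is weakly persistent if $f^n\in\mathsf{G}(I^n)$ for all $n\in\mathbb{N}$; $P^{\ast}(I)$ is the set of weakly persistent generators. $\delta_P:=\max_{1\le i\le k}\min\{\operatorname{dist}_x(g_i,g_{i+1}),\operatorname{dist}_y(g_i,g_{i+1})\}-1$,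 and $d_P:=\min\{\operatorname{dist}_x(I),\operatorname{dist}_y(I)\}-2$ if $|P|>2$, $d_P:=0$ if $|P|=2$. *)

(* Defs.v *)
From mathcomp Require Import all_boot all_order all_algebra.
From mathcomp Require Import finmap.
From mathcomp Require Import boolp classical_sets functions cardinality.
From mathcomp Require Import mpoly.

Set Implicit Arguments.
Unset Strict Implicit.
Unset Printing Implicit Defensive.

Import GRing.Theory Num.Theory.
Local Open Scope classical_set_scope.
Local Open Scope ring_scope.

(* A monomial is its exponent vector m : 'X_{1..2}; the corresponding element
   of k[x,y] is 'X_[m], divisibility is (m <= n)%MM, and m^n is (m *+ n)%MM. *)
Definition xvar : 'I_2 := ord0.
Definition yvar : 'I_2 := ord_max.

(* Ideals are plain sets of polynomials rather than the boolean predicates of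
   ring_quotient, which in addition have to be proper. *)
Section Ideals.
Variable K : fieldType.
Implicit Types (I J : set {mpoly K[2]}) (m g h : 'X_{1..2}).

Definition is_ideal I : Prop :=
  [/\ I 0, forall p q, I p -> I q -> I (p + q)
    & forall a p, I p -> I (a * p)].

Definition ideal_gen (A : set {mpoly K[2]}) : set {mpoly K[2]} :=
  smallest is_ideal A.

Definition ideal_mul I J : set {mpoly K[2]} :=
  ideal_gen [set p * q | p in I & q in J].

Definition ideal_exp I (n : nat) : set {mpoly K[2]} :=
  iter n (ideal_mul I) setT.

Definition ideal_sum (k : nat) (J : 'I_k -> set {mpoly K[2]}) :
    set {mpoly K[2]} :=
  ideal_gen (\bigcup_i J i).

Definition ideal_colon I (f : {mpoly K[2]}) : set {mpoly K[2]} :=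
  [set p | I (p * f)].

Definition principal I : Prop :=
  exists p : {mpoly K[2]}, I = ideal_gen [set p].

Definition monomial_gen (S : set 'X_{1..2}) : set {mpoly K[2]} :=
  ideal_gen [set 'X_[m] | m in S].

Definition monomial_ideal I : Prop :=
  exists S : set 'X_{1..2}, I = monomial_gen S.

Definition monomials I : set 'X_{1..2} := [set m | I 'X_[m]].

(* The default value set0 is only used if I is not a monomial ideal. *)
Definition mingens I : set 'X_{1..2} :=
  xget set0 [set S | I = monomial_gen S /\
    forall S' : set 'X_{1..2}, S' `<=` S -> I = monomial_gen S' -> S' = S].

Definition mu I : nat := #|` fset_set (mingens I)|.

(* The default value is only used if I contains no monomial. *)
Definition ideal_gcd I : 'X_{1..2} :=
  xget 0%MM [set d : 'X_{1..2} | (forall m, monomials I m -> (d <= m)%MM) /\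
    forall e : 'X_{1..2},
      (forall m, monomials I m -> (e <= m)%MM) -> (e <= d)%MM].

(* By Dickson's lemma the maximum ranges over a finite set. *)
Definition dist (v : 'I_2) I : nat :=
  (\max_(m <- fset_set (mingens (ideal_colon I 'X_[ideal_gcd I]))) m v)%N.

Definition int_closure I : set {mpoly K[2]} :=
  monomial_gen
    [set f | exists2 n : nat, (0 < n)%N & ideal_exp I n ('X_[f] ^+ n)].

Definition persistent I : set 'X_{1..2} :=
  [set f | mingens I f /\
    forall g h, monomials I g -> monomials I h -> g <> f -> h <> f ->
      ~ int_closure (monomial_gen [set g; h]) 'X_[f]].

Definition weakly_persistent I : set 'X_{1..2} :=
  [set f | mingens I f /\
    forall n : nat, (0 < n)%N -> mingens (ideal_exp I n) (f *+ n)%MM].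

Definition d_of I (P : set 'X_{1..2}) : int :=
  if (2 < #|` fset_set P|)%N
  then (minn (dist xvar I) (dist yvar I))%:Z - 2
  else 0.

End Ideals.

(* The ideal (g_i, g_(i+1)), where the tuple entries are numbered from 0. *)
Definition pair_ideal (K : fieldType) (k : nat) (g : k.+1.-tuple 'X_{1..2})
    (i : 'I_k) : set {mpoly K[2]} :=
  monomial_gen [set nth 0%MM g i; nth 0%MM g i.+1].
Arguments pair_ideal K {k} g i _.

Definition delta_of (K : fieldType) (k : nat) (g : k.+1.-tuple 'X_{1..2}) :
    int :=
  (\max_(i < k) minn (dist xvar (pair_ideal K g i))
                     (dist yvar (pair_ideal K g i)))%N%:Z - 1.

(* Main.v *)
Require Import Defs.
From mathcomp Require Import all_boot all_order all_algebra.
From mathcomp Require Import finmap.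
From mathcomp Require Import boolp classical_sets functions cardinality.
From mathcomp Require Import mpoly.
From mathcomp Require Import zify.

Set Implicit Arguments.
Unset Strict Implicit.
Unset Printing Implicit Defensive.

Import GRing.Theory Num.Theory.
Local Open Scope classical_set_scope.
Local Open Scope ring_scope.

(** A monomial of I^(D+l) is divisible by a product of D+l minimal generators,
    that is, by the sum of a sequence [s] of exponent vectors.  Two kinds of
    exchange replace part of [s] by as many generators without enlarging the
    sum.

    - A minimal generator f outside P lies weakly above the chord of two
      consecutive elements p, q of P ([above_chord]).  If c is the width of
      this chord in one of the two coordinates, then p^a q^b divides f^c for
      some a, b with a + b = c.
    - For nonconsecutive p, q in P, an element f of P between them lies weakly
      below their chord ([chain_chord]), so that conversely f^(a+b) divides
      p^a q^b, where a + b is the width of the chord in a chosen coordinate.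

    The first exchange lowers the number of factors outside P.  The second one
    keeps it and lowers the sum of the squares of the chosen coordinate of the
    factors, because it replaces copies of p and q by copies of their weighted
    mean in that coordinate.  At a lexicographic minimum of these two numbers
    no exchange is possible
    ([reduced_product]): every generator outside P occurs at most delta_P
    times, and of two nonconsecutive elements of P one occurs at most d_P
    times.  Hence all elements of P, except two consecutive ones, occur at
    most d_P times, and the bound on D leaves at least l factors for these two
    ([heavy_pair], [consecutive_factors]).

    Both positions relative to a chord are convexity facts about the Newton
    polygon.  The statement on P holds since a power of a weakly persistent p
    strictly above a chord would be properly divisible by a product of other
    monomials of I ([weakly_persistent_chord]).  For f outside P, suppose that
    f is strictly below the chord of its neighbours in P, and minimize over I
    the linear form that is constant on this chord.  With ties broken, a
    minimizer is a vertex of the Newton polygon, hence persistent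
    ([lex_min_persistent]) and in P, but the elements of P do not lie strictly
    below the chord. *)

(** * Monomial ideals as up-sets of exponent vectors *)

Section MonomialIdeals.
Variable K : fieldType.
Implicit Types (I J : set {mpoly K[2]}) (S T M : set 'X_{1..2}).
Implicit Types (m d : 'X_{1..2}).

Lemma ideal_gen_ideal (A : set {mpoly K[2]}) : is_ideal (ideal_gen A).
Proof.
split=> [B [[B0 _ _] _] //|p q Ap Aq B AB|a p Ap B AB].
- by have [[_ BD _] _] := AB; apply: BD; [apply: Ap|apply: Aq].
- by have [[_ _ BM] _] := AB; apply: BM; apply: Ap.
Qed.

Lemma ideal_gen_sub (A J : set {mpoly K[2]}) :
  is_ideal J -> A `<=` J -> ideal_gen A `<=` J.
Proof. exact: smallest_sub. Qed.

(** The support criterion carries everything about monomial ideals: by it, a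
    claim about ideals becomes one about divisibility of monomials. *)
Lemma monomial_genP S (p : {mpoly K[2]}) :
  monomial_gen S p <->
  forall m, m \in msupp p -> exists2 s, S s & (s <= m)%MM.
Proof.
split; last first.
  have [I0 ID IM] := ideal_gen_ideal [set 'X_[K, m] | m in S].
  move=> Sp; rewrite [p]mpolyE big_seq.
  apply: (big_ind (fun q => monomial_gen S q)) => // m /Sp[s Ss sm].
  rewrite -mul_mpolyC -(submK sm) mpolyXD mulrA; apply: IM.
  by apply: sub_gen_smallest; exists s.
pose J : set {mpoly K[2]} :=
  [set q | forall m, m \in msupp q -> exists2 s, S s & (s <= m)%MM].
apply: (@ideal_gen_sub _ J) => [|_ [s Ss <-] m]; last first.
  by rewrite msuppX inE => /eqP ->; exists s => //; apply: lepm_refl.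
split=> [m|q r Jq Jr m|a q Jq m]; first by rewrite msupp0.
  by move/msuppD_le; rewrite mem_cat => /orP[/Jq|/Jr].
move/msuppM_le/allpairsP => [[m1 m2] /= [_ /Jq[s Ss sm] ->]].
by exists s => //; apply: lepm_trans sm (lem_addl _ _).
Qed.

Lemma monomial_genX S m :
  monomial_gen (K := K) S 'X_[m] <-> exists2 s, S s & (s <= m)%MM.
Proof.
rewrite monomial_genP; split=> [|Sm n]; last by rewrite msuppX inE => /eqP ->.
by apply; rewrite msuppX inE.
Qed.

Lemma monomial_gen_sub S T :
  (forall s, S s -> exists2 t, T t & (t <= s)%MM) ->
  monomial_gen (K := K) S `<=` monomial_gen T.
Proof.
move=> ST p /monomial_genP Sp; apply/monomial_genP => m /Sp[s /ST[t Tt ts] sm].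
by exists t => //; apply: lepm_trans ts sm.
Qed.

Lemma monomials_gen S : monomial_gen (monomials (monomial_gen (K := K) S)) =
  monomial_gen (K := K) S.
Proof.
apply/seteqP; split; apply: monomial_gen_sub => s; first by move/monomial_genX.
by move=> Ss; exists s; [apply/monomial_genX; exists s|]; rewrite ?lepm_refl.
Qed.

Lemma ideal_mul_gen S T : ideal_mul (monomial_gen (K := K) S) (monomial_gen T) =
  monomial_gen [set (s + t)%MM | s in S & t in T].
Proof.
apply/seteqP; split; (apply: ideal_gen_sub; first exact: ideal_gen_ideal).
- move=> _ [p /monomial_genP Sp [q /monomial_genP Tq <-]].
  apply/monomial_genP => m /msuppM_le/allpairsP[[m1 m2] /=].
  move=> [/Sp[s Ss sm1] /Tq[t Tt tm2] ->].
  exists (s + t)%MM; first by exists s => //; exists t.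
  apply/mnm_lepP => i.
  by rewrite !mnmDE leq_add ?(mnm_lepP sm1) ?(mnm_lepP tm2).
- move=> _ [_ [s Ss [t Tt <-]] <-]; apply: sub_gen_smallest.
  exists 'X_[s]; first by apply/monomial_genX; exists s; rewrite ?lepm_refl.
  exists 'X_[t]; first by apply/monomial_genX; exists t; rewrite ?lepm_refl.
  by rewrite mpolyXD.
Qed.

(** The exponent vectors of the products of n monomials from [S].  Sequences
    rather than multiplicity functions, so that factors can be exchanged up to
    permutation. *)
Definition nfold S (n : nat) : set 'X_{1..2} :=
  [set m | exists s : seq 'X_{1..2},
    [/\ size s = n, forall x, x \in s -> S x & m = (\sum_(x <- s) x)%MM]].

Lemma ideal_exp_gen S (n : nat) :
  ideal_exp (monomial_gen (K := K) S) n = monomial_gen (nfold S n).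
Proof.
elim: n => [|n IH] /=.
  apply/seteqP; split=> // p _; apply/monomial_genP => m _.
  exists 0%MM; last by apply/mnm_lepP => i; rewrite mnm0E.
  by exists [::]; split=> //; rewrite big_nil.
rewrite [LHS]/= -/(ideal_exp _ n) IH ideal_mul_gen; congr monomial_gen.
apply/seteqP; split=> m.
  move=> [x Sx [_ [s [sz Ss ->]] <-]]; exists (x :: s); split => /=.
  - by rewrite sz.
  - by move=> y; rewrite inE => /orP[/eqP->|/Ss].
  - by rewrite big_cons.
move=> [[|x s] [//= [sz] Ss ->]].
exists x; first by apply: Ss; rewrite mem_head.
rewrite big_cons; exists (\sum_(x <- s) x)%MM => //; exists s; split=> // y ys.
by apply: Ss; rewrite inE ys orbT.
Qed.

Lemma ideal_sum_gen k (S : 'I_k -> set 'X_{1..2}) :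
  ideal_sum (fun i => monomial_gen (K := K) (S i)) =
  monomial_gen (\bigcup_i S i).
Proof.
apply/seteqP; split; (apply: ideal_gen_sub; first exact: ideal_gen_ideal).
- move=> p [i _]; apply: monomial_gen_sub => s Ss.
  by exists s; [exists i | apply: lepm_refl].
- move=> _ [s [i _ Ss] <-]; apply: sub_gen_smallest; exists i => //.
  by apply/monomial_genX; exists s; rewrite ?lepm_refl.
Qed.

Lemma ideal_colon_gen S d : (forall s, S s -> (d <= s)%MM) ->
  ideal_colon (monomial_gen S) 'X_[K, d] =
  monomial_gen [set (s - d)%MM | s in S].
Proof.
move=> dS; apply/seteqP; split=> p; rewrite /ideal_colon /=;
  move=> /monomial_genP Sp; apply/monomial_genP => m.
  move=> mp; have [|s Ss sm] := Sp (d + m)%MM.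
    by rewrite (perm_mem (msuppMX _ _)) map_f.
  exists (s - d)%MM; first by exists s.
  apply/mnm_lepP => i; rewrite mnmBE leq_subLR -mnmDE.
  exact: (mnm_lepP sm).
rewrite (perm_mem (msuppMX _ _)) => /mapP[n /Sp[_ [s Ss <-] sn] ->].
exists s => //; apply/mnm_lepP => i; move/mnm_lepP/(_ i): sn.
by rewrite mnmBE leq_subLR -mnmDE.
Qed.

Lemma lex_min (T : Type) (A : set T) (u v : T -> nat) : A !=set0 ->
  exists2 a, A a & forall b, A b ->
    (u a < u b)%N \/ u a = u b /\ (v a <= v b)%N.
Proof.
have nat_min (B : set T) (w : T -> nat) : B !=set0 ->
    exists2 a, B a & forall b, B b -> (w a <= w b)%N.
  move=> [b Bb]; have exw : exists n, `[< exists2 c, B c & w c = n >].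
    by exists (w b); apply/asboolP; exists b.
  case: (ex_minnP exw) => n /asboolP[c Bc <-] minc.
  by exists c => // e Be; apply: minc; apply/asboolP; exists e.
move=> /(nat_min _ u)[a0 Aa0 mina0].
have [|a [Aa ua] mina] := nat_min [set a | A a /\ u a = u a0] v.
  by exists a0.
exists a => // b Ab; have := mina0 b Ab; rewrite -ua leq_eqVlt.
by case/orP => [/eqP e|]; [right; split=> //; apply: mina; rewrite -ua e|left].
Qed.

Definition min_elts M : set 'X_{1..2} :=
  [set m | M m /\ forall n, M n -> (n <= m)%MM -> n = m].

Lemma min_elts_le M m : M m -> exists2 n, min_elts M n & (n <= m)%MM.
Proof.
move=> Mm; have [|a [Ma am] mina] :=
    @lex_min _ [set n | M n /\ (n <= m)%MM] (@mdeg 2) (fun=> 0%N).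
  by exists m; split=> //; apply: lepm_refl.
exists a => //; split=> // n Mn na.
have := mdegD (a - n) n; rewrite submK // => e.
have [|le_deg|[le_deg _]] := mina n.
- by split=> //; apply: lepm_trans na am.
- by rewrite e ltnNge leq_addl in le_deg.
move/eqP: e; rewrite le_deg -[X in X == _]add0n eqn_add2r.
by rewrite eq_sym mdeg_eq0 => /eqP e; rewrite -[a](submK na) e add0m.
Qed.

(** A set of generators of a monomial ideal contains all minimal monomials of
    the ideal, and these suffice to generate it, so that the minimal generating
    set is unique. *)
Lemma mingensE S : mingens (monomial_gen (K := K) S) =
  min_elts (monomials (monomial_gen (K := K) S)).
Proof.
set I := monomial_gen S; set M := min_elts _.
have IM : I = monomial_gen M.
  rewrite {1}/I -monomials_gen.
  apply/seteqP; split; apply: monomial_gen_sub => m.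
    exact: min_elts_le.
  by move=> [Im _]; exists m; rewrite ?lepm_refl.
have subM (S' : set 'X_{1..2}) : I = monomial_gen S' -> M `<=` S'.
  move=> IS' m [Im minm].
  have := Im; rewrite /monomials /= IS' => /monomial_genX.
  move=> [s S's sm]; rewrite -(minm s) //= /monomials /= IS'.
  by apply/monomial_genX; exists s; rewrite ?lepm_refl.
apply: xget_unique => [|S' [IS' minS']].
  by split=> // S' S'M IS'; apply/seteqP; split=> //; apply: subM.
by symmetry; apply: minS' => //; apply: subM.
Qed.

Lemma monomial_ideal_mingens I : monomial_ideal I ->
  I = monomial_gen (mingens I).
Proof.
move=> [S ->]; rewrite mingensE -{1}monomials_gen.
apply/seteqP; split; apply: monomial_gen_sub => m; first exact: min_elts_le.
by move=> [Im _]; exists m; rewrite ?lepm_refl.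
Qed.

Lemma mnm2_eq m (n : 'X_{1..2}) : m xvar = n xvar -> m yvar = n yvar -> m = n.
Proof.
move=> ex ey; apply/mnmP => i; case: (unliftP xvar i) => [j ->|-> //].
have -> : lift xvar j = yvar by apply/val_inj; rewrite /= (ord1 j).
by [].
Qed.

Lemma mnm2_le m (n : 'X_{1..2}) :
  (m <= n)%MM = (m xvar <= n xvar)%N && (m yvar <= n yvar)%N.
Proof.
apply/mnm_lepP/andP => [le|[lex ley] i]; first by split.
case: (unliftP xvar i) => [j ->|-> //].
by have -> : lift xvar j = yvar by apply/val_inj; rewrite /= (ord1 j).
Qed.

Lemma mdeg2 m : mdeg m = (m xvar + m yvar)%N.
Proof.
rewrite mdegE !big_ord_recl big_ord0 addn0; congr (m _ + m _)%N.
exact/val_inj.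
Qed.

(** Dickson's lemma in two variables: a minimal element exceeds neither the
    y-degree of an element of least x-degree nor the x-degree of an element of
    least y-degree. *)
Lemma min_elts_finite M : finite_set (min_elts M).
Proof.
have [->|/set0P[e [Me _]]] := eqVneq (min_elts M) set0.
  exact: finite_set0.
have [|a Ma mina] := @lex_min _ M (fun m => m xvar) (fun=> 0%N).
  by exists e.
have [|b Mb minb] := @lex_min _ M (fun m => m yvar) (fun=> 0%N).
  by exists e.
pose B := (b xvar + a yvar).+1.
pose box := [set bmnm m | m in [set: 'X_{1..2 < B}]].
apply: (@sub_finite_set _ _ box); last first.
  by apply: finite_image; apply: finite_finset.
move=> m [Mm minm].
have mx : (m xvar <= b xvar)%N.
  rewrite leqNgt; apply/negP => lt; have /(congr1 (fun m => m xvar)) : b = m.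
    apply: minm => //; rewrite mnm2_le ltnW //=.
    by case: (minb m Mm) => [/ltnW|[->]].
  by move=> e'; rewrite e' ltnn in lt.
have my : (m yvar <= a yvar)%N.
  rewrite leqNgt; apply/negP => lt; have /(congr1 (fun m => m yvar)) : a = m.
    apply: minm => //; rewrite mnm2_le andbC ltnW //=.
    by case: (mina m Mm) => [/ltnW|[->]].
  by move=> e'; rewrite e' ltnn in lt.
have mB : (mdeg m < B)%N by rewrite mdeg2 ltnS leq_add.
by exists (BMultinom mB).
Qed.

(** Dividing by the gcd, which divides [n], translates all minimal generators
    by the same vector.  [dist] enters the theorem through a lower bound on D,
    so it is to be bounded from below. *)
Lemma dist_ge I v m n : monomial_ideal I -> mingens I m -> mingens I n ->
  (m v - n v <= dist v I)%N.
Proof.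
move=> [S IS]; rewrite IS mingensE => -[Im minm] [In _].
set d := ideal_gcd (monomial_gen (K := K) S).
have dI : forall a, monomials (monomial_gen (K := K) S) a -> (d <= a)%MM.
  suff [] : [set d : 'X_{1..2} |
      (forall m, monomials (monomial_gen (K := K) S) m -> (d <= m)%MM) /\
      forall e : 'X_{1..2},
        (forall m, monomials (monomial_gen (K := K) S) m -> (e <= m)%MM) ->
        (e <= d)%MM] d by [].
  have low w : exists2 a, monomials (monomial_gen (K := K) S) a &
      forall b, monomials (monomial_gen (K := K) S) b -> (a w <= b w)%N.
    have [|a Ia mina] := @lex_min _ (monomials (monomial_gen (K := K) S))
      (fun m => m w) (fun=> 0%N); first by exists m.
    by exists a => // b /mina[/ltnW|[->]].
  apply: xgetPex; have [ax Iax lex] := low xvar; have [ay Iay ley] := low yvar.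
  exists [multinom (if i == xvar then ax xvar else ay yvar) | i < 2].
  split=> [a Ia|a aI].
    by rewrite mnm2_le !mnmE /= lex ?ley.
  rewrite mnm2_le !mnmE /=; apply/andP.
  by split; [apply: (mnm_lepP (aI _ Iax))|apply: (mnm_lepP (aI _ Iay))].
have colonE : ideal_colon (monomial_gen S) 'X_[K, d] =
    monomial_gen [set (s - d)%MM | s in monomials (monomial_gen (K := K) S)].
  by rewrite -[in LHS]monomials_gen ideal_colon_gen.
have md : mingens (ideal_colon (monomial_gen S) 'X_[K, d]) (m - d)%MM.
  rewrite colonE mingensE; split.
    by apply/monomial_genX; exists (m - d)%MM; [exists m|apply: lepm_refl].
  move=> a; rewrite /monomials /= -colonE /ideal_colon /= -mpolyXD => Iad le.
  have /(canRL (addmK _)) // : (a + d)%MM = m.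
  apply: minm => //; rewrite -(submK (dI _ Im)).
  by apply/mnm_lepP => i; rewrite !mnmDE leq_add2r (mnm_lepP le).
apply: leq_trans (_ : ((m - d)%MM v <= _)%N).
  by rewrite mnmBE leq_sub2l // (mnm_lepP (dI _ In)).
rewrite /dist -/d; set F := fset_set _.
have mF : (m - d)%MM \in F.
  rewrite in_fset_set ?inE // colonE mingensE; exact: min_elts_finite.
exact: (leq_bigmax_seq (F := fun m : 'X_{1..2} => m v) _ mF).
Qed.

End MonomialIdeals.

(** * Chords and extremal points of the Newton polygon *)

Lemma big_nseq_mnm (n : nat) (m : 'X_{1..2}) :
  (\sum_(x <- nseq n m) x = m *+ n)%MM.
Proof. by apply/mnmP => i; rewrite mnm_sumE mulmnE big_nseq iter_addn_0. Qed.

(** The lexicographic order on pairs of numbers is compatible with addition. *)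
Lemma sum_lex_lt (T : eqType) (u v : T -> nat) (f : T) (s : seq T) :
  (forall x, x \in s -> u f < u x \/ u f = u x /\ v f < v x)%N ->
  s != [::] ->
  (u f * size s < \sum_(x <- s) u x \/
   u f * size s = \sum_(x <- s) u x /\ v f * size s < \sum_(x <- s) v x)%N.
Proof.
elim: s => // x s IHs lt _; rewrite !big_cons /= !mulnS.
have := lt x (mem_head _ _); have [->|s0] := eqVneq s [::].
  by rewrite !big_nil /=; lia.
have {}IH : forall y, y \in s -> (u f < u y)%N \/ u f = u y /\ (v f < v y)%N.
  by move=> y ys; apply: lt; rewrite inE ys orbT.
by case: (IHs IH s0); lia.
Qed.

(** For f between p and q, take the weights that balance p and q against f in
    the coordinate v, the opposite differences of the v-degrees.  In the other
    coordinate the comparison then has the sign of a determinant that does not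
    depend on v: the position of f relative to the chord.  The freedom in v is
    what lets the minimum of the two distances bound [a + b]. *)
Lemma segment_weights (p q f : 'X_{1..2}) (v : 'I_2) :
  (p xvar < f xvar < q xvar -> q yvar < f yvar < p yvar ->
  let chord := (q xvar - f xvar) * p yvar + (f xvar - p xvar) * q yvar in
  exists a b, [/\ [/\ 0 < a, 0 < b & a + b = (p v - q v) + (q v - p v)],
    a * p v + b * q v = (a + b) * f v,
    (q xvar - p xvar) * f yvar <= chord ->
      (f *+ (a + b) <= p *+ a + q *+ b)%MM
  & chord <= (q xvar - p xvar) * f yvar ->
      (p *+ a + q *+ b <= f *+ (a + b))%MM])%N.
Proof.
move=> hx hy /=.
have [s [t [ex1 ex2]]] : exists s t,
    (f xvar = p xvar + s.+1 /\ q xvar = p xvar + s.+1 + t.+1)%N.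
  by exists (f xvar - p xvar).-1, (q xvar - f xvar).-1; lia.
have [z [w [ey1 ey2]]] : exists z w,
    (f yvar = q yvar + z.+1 /\ p yvar = q yvar + z.+1 + w.+1)%N.
  by exists (f yvar - q yvar).-1, (p yvar - f yvar).-1; lia.
have [->|->] : v = xvar \/ v = yvar.
  by case: v => -[|[|//]] ?; [left|right]; apply: val_inj.
- exists t.+1, s.+1; rewrite !mnm2_le !mnmDE !mulmnE ex1 ex2 ey1 ey2.
  by split; [split; lia|nia|move=> h; apply/andP; split; nia..].
- exists z.+1, w.+1; rewrite !mnm2_le !mnmDE !mulmnE ex1 ex2 ey1 ey2.
  by split; [split; lia|nia|move=> h; apply/andP; split; nia..].
Qed.

Section Persistence.
Variables (K : fieldType) (I : set {mpoly K[2]}).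
Hypothesis I_mon : monomial_ideal I.

Lemma monomial_idealE : I = monomial_gen (monomials I).
Proof. by have [S ->] := I_mon; rewrite monomials_gen. Qed.

Lemma mingens_min : mingens I = min_elts (monomials I).
Proof. by have [S ->] := I_mon; rewrite mingensE. Qed.

Lemma mingens_antichain m n : mingens I m -> mingens I n ->
  (m <= n)%MM -> m = n.
Proof. by rewrite mingens_min => -[Im _] [_]; apply. Qed.

(** If p were strictly above the chord of m and n, then a product of powers of
    m and n with the x-degree of p^(n_x - m_x) and a smaller y-degree would
    show that this power of p is not a minimal generator. *)
Lemma weakly_persistent_chord p m n :
  weakly_persistent I p -> monomials I m -> monomials I n ->
  (m xvar < p xvar < n xvar)%N ->
  ((n xvar - m xvar) * p yvar <=
   (n xvar - p xvar) * m yvar + (p xvar - m xvar) * n yvar)%N.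
Proof.
move=> [_ wp] Im In hx; rewrite leqNgt; apply/negP => lt.
set a := (n xvar - p xvar)%N in lt; set b := (p xvar - m xvar)%N in lt.
have ab : (n xvar - m xvar = a + b)%N by rewrite /a /b; lia.
have := wp (n xvar - m xvar)%N.
rewrite ab monomial_idealE ideal_exp_gen mingensE.
case=> [|_ /(_ (m *+ a + n *+ b)%MM)]; first by lia.
have le : (m *+ a + n *+ b <= p *+ (a + b))%MM.
  rewrite mnm2_le !mnmDE !mulmnE; apply/andP; split; nia.
move=> /(_ _ le) e.
have : (m *+ a + n *+ b = p *+ (a + b))%MM.
  apply: e; apply/monomial_genX.
  exists (m *+ a + n *+ b)%MM; last exact: lepm_refl.
  exists (nseq a m ++ nseq b n); split; first by rewrite size_cat !size_nseq.
    by move=> x; rewrite mem_cat !mem_nseq => /orP[]/andP[_ /eqP->].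
  by rewrite big_cat !big_nseq_mnm.
move=> /(congr1 (fun m : 'X_{1..2} => m yvar)).
rewrite mnmDE !mulmnE; nia.
Qed.

(** The second form breaks ties: the minimizer f is then unique.  If f lay in
    the integral closure of two other monomials of I, some multiple of f would
    dominate a sum of as many copies of these, which is lexicographically
    larger. *)
Lemma lex_min_persistent (a b c d : nat) :
  let u (m : 'X_{1..2}) := (a * m xvar + b * m yvar)%N in
  let v (m : 'X_{1..2}) := (c * m xvar + d * m yvar)%N in
  (forall m n, u m = u n -> v m = v n -> m = n) ->
  monomials I !=set0 ->
  exists2 f, persistent I f & forall m, monomials I m -> (u f <= u m)%N.
Proof.
move=> u v uv_inj /(lex_min u v)[f If minf]; exists f; last first.
  by move=> m /minf[/ltnW|[->]].
have u_le m n : (m <= n)%MM -> (u m <= u n)%N.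
  by rewrite mnm2_le => /andP[hx hy]; rewrite leq_add ?leq_mul.
have v_le m n : (m <= n)%MM -> (v m <= v n)%N.
  by rewrite mnm2_le => /andP[hx hy]; rewrite leq_add ?leq_mul.
have u_sum s : u (\sum_(x <- s) x)%MM = (\sum_(x <- s) u x)%N.
  by rewrite /u !mnm_sumE !big_distrr -big_split.
have v_sum s : v (\sum_(x <- s) x)%MM = (\sum_(x <- s) v x)%N.
  by rewrite /v !mnm_sumE !big_distrr -big_split.
split.
  rewrite mingens_min; split=> // n In nf.
  have := u_le _ _ nf; have := v_le _ _ nf.
  by case: (minf n In) => [|[e le]] *; [lia|apply: uv_inj; lia].
move=> g h Ig Ih gf hf /monomial_genX[e [n n0 en]] ef.
move: en; rewrite mpolyXn ideal_exp_gen => /monomial_genX[_ [s [sz sgh ->]] le].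
have lt x : x \in s -> (u f < u x)%N \/ u f = u x /\ (v f < v x)%N.
  move=> xs; have [Ix xf] : monomials I x /\ x <> f by case: (sgh x xs) => ->.
  case: (minf x Ix) => [|[ux vx]]; [by left|right; split=> //].
  rewrite ltn_neqAle vx andbT; apply/eqP => vx'; apply: xf.
  by apply: uv_inj; symmetry.
have s0 : s != [::] by rewrite -size_eq0 sz -lt0n.
have lef : (\sum_(x <- s) x <= f *+ n)%MM.
  apply: lepm_trans le _; apply/mnm_lepP => i.
  by rewrite !mulmnE leq_mul2r (mnm_lepP ef) orbT.
have := sum_lex_lt lt s0; rewrite sz -u_sum -v_sum.
have := u_le _ _ lef; have := v_le _ _ lef.
rewrite /u /v !mulmnE; nia.
Qed.

End Persistence.

(** * Exchanging factors *)

Lemma perm_nseq_count (T : eqType) (n : nat) (x : T) (s : seq T) :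
  (n <= count_mem x s)%N -> exists r, perm_eq s (nseq n x ++ r).
Proof.
elim: n s => [|n IH] s le; first by exists s.
have xs : x \in s by rewrite -has_pred1 has_count; apply: leq_trans le.
have ps := perm_to_rem xs.
have [|r pr] := IH (rem x s).
  by move: le; rewrite (permP ps) /= eqxx.
by exists r; rewrite (perm_trans ps) //= perm_cons.
Qed.

Lemma perm_nseq_count2 (T : eqType) (a b : nat) (x y : T) (s : seq T) :
  x != y -> (a <= count_mem x s)%N -> (b <= count_mem y s)%N ->
  exists r, perm_eq s ((nseq a x ++ nseq b y) ++ r).
Proof.
move=> xy /perm_nseq_count[r pr].
rewrite (permP pr) count_cat count_nseq /= (negPf xy).
move=> /perm_nseq_count[q pq]; exists q.
by rewrite -catA (perm_trans pr) // perm_cat2l.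
Qed.

(** Strict convexity of the square. *)
Lemma sum_sqr_lt (a b p q f : nat) : (0 < a)%N -> (0 < b)%N -> p <> q ->
  (a * p + b * q = (a + b) * f)%N ->
  ((a + b) * f ^ 2 < a * p ^ 2 + b * q ^ 2)%N.
Proof.
move=> a0 b0 pq e; have ab0 : (0 < a + b)%N by rewrite addn_gt0 a0.
rewrite -(ltn_pmul2l ab0).
have -> : ((a + b) * ((a + b) * f ^ 2) = ((a + b) * f) ^ 2)%N by lia.
have : (0 < a * b)%N by rewrite muln_gt0 a0.
by rewrite -e; case: (ltngtP p q) => // lt; rewrite -(subnK lt); nia.
Qed.

Lemma sum_count_mem (T : eqType) (r s : seq T) : uniq r ->
  (\sum_(x <- r) count_mem x s)%N = count (mem r) s.
Proof.
move=> ur; elim: s => [|y s IH] /=; first by rewrite big1.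
rewrite big_split /= IH; congr (_ + _)%N.
rewrite -(count_uniq_mem y ur) -sum1_count [RHS]big_mkcond /=.
by apply: eq_bigr => x _; rewrite eq_sym; case: (x == y).
Qed.

Lemma sum_seq_leq (T : eqType) (r : seq T) (F : T -> nat) (c : nat) :
  (forall x, x \in r -> F x <= c)%N -> (\sum_(x <- r) F x <= size r * c)%N.
Proof.
elim: r => [|x r IH] le; first by rewrite big_nil.
rewrite big_cons mulSn leq_add ?le ?mem_head ?IH // => y yr.
by rewrite le // inE yr orbT.
Qed.

(** All i with [c i] above b lie in a window of two consecutive indices, which
    starts at the least such i, or at [k.-1] if that is [k]. *)
Lemma heavy_pair (k b l : nat) (c : nat -> nat) : (0 < k)%N ->
  (k.+1 * b + l <= \sum_(0 <= i < k.+1) c i)%N ->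
  (forall i j, i.+1 < j <= k -> c i <= b \/ c j <= b)%N ->
  exists2 i, (i < k)%N & (l <= c i + c i.+1)%N.
Proof.
move=> k0 le light.
have [i ik out] : exists2 i, (i < k)%N &
    forall t, (t <= k)%N -> t != i -> t != i.+1 -> (c t <= b)%N.
  have [ex|no] := pselect (exists t, (t <= k)%N && (b < c t)%N); last first.
    exists 0%N => // t tk _ _; rewrite leqNgt; apply/negP => ct.
    by apply: no; exists t; rewrite tk.
  case: (ex_minnP ex) => t /andP[tk ct] mint.
  exists (minn t k.-1); first by lia.
  move=> s sk s1 s2; rewrite leqNgt; apply/negP => cs.
  have := mint s; rewrite sk cs => /(_ isT) ts; have := light t s; lia.
exists i => //.
have : (\sum_(0 <= t < k.+1) c t <= \sum_(0 <= t < k.+1)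
   (b + (if t == i then c t else 0) + (if t == i.+1 then c t else 0)))%N.
  rewrite !big_mkord; apply: leq_sum => -[t tk] _ /=.
  have := out t tk.
  by case: (eqVneq t i) => [->|_]; case: (eqVneq _ i.+1) => [->|_] /= h; lia.
rewrite !big_split /= sum_nat_const_nat -!big_mkcond !big_nat1_eq /=.
rewrite !ltnS (ltnW ik) ik; lia.
Qed.

Lemma dist_span (K : fieldType) (I : set {mpoly K[2]}) w m n :
  monomial_ideal I -> mingens I m -> mingens I n ->
  ((m w - n w) + (n w - m w) <= dist w I)%N.
Proof.
move=> I_mon Gm Gn.
have := dist_ge w I_mon Gm Gn; have := dist_ge w I_mon Gn Gm; lia.
Qed.

Lemma minn_dist (K : fieldType) (J : set {mpoly K[2]}) :
  exists w, dist w J = minn (dist xvar J) (dist yvar J).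
Proof. by case: leqP => _; [exists xvar|exists yvar]. Qed.

(** * The chain of elements of P *)

Lemma crossing_index (F : nat -> nat) (n c : nat) :
  (F 0 < c <= F n)%N -> exists2 i, (i < n)%N & (F i < c <= F i.+1)%N.
Proof.
move=> /andP[F0 Fn]; have exF : exists j, (c <= F j)%N by exists n.
case: (ex_minnP exF) => [[|j] Fj minj]; first by lia.
exists j; first exact: minj.
by rewrite Fj andbT ltnNge; apply/negP => /minj; rewrite ltnn.
Qed.

Section Chain.
Variables (K : fieldType) (I : set {mpoly K[2]}).
Hypothesis I_mon : monomial_ideal I.

Lemma mingens_monomials m : mingens I m -> monomials I m.
Proof. by rewrite mingens_min // => -[]. Qed.

Lemma mingens_lt m n : mingens I m -> mingens I n ->
  (n yvar < m yvar)%N = (m xvar < n xvar)%N.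
Proof.
move=> Gm Gn; apply/idP/idP => lt; rewrite ltnNge; apply/negP => le.
  have e : n = m.
    by apply: (mingens_antichain I_mon Gn Gm); rewrite mnm2_le le ltnW.
  by rewrite e ltnn in lt.
have e : m = n.
  by apply: (mingens_antichain I_mon Gm Gn); rewrite mnm2_le le ltnW.
by rewrite e ltnn in lt.
Qed.

Variables (k : nat) (g : k.+1.-tuple 'X_{1..2}).
Hypothesis persistent_g : persistent I `<=` [set` g].
Hypothesis g_weakly_persistent : [set` g] `<=` weakly_persistent I.
Hypothesis g_desc : sorted (fun m n : 'X_{1..2} => (n yvar < m yvar)%N) g.

Notation v i := (nth 0%MM g i).

Lemma chain_mem i : (i <= k)%N -> v i \in g.
Proof. by move=> ik; rewrite mem_nth // size_tuple. Qed.

Lemma chain_mingens i : (i <= k)%N -> mingens I (v i).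
Proof. by move=> /chain_mem /g_weakly_persistent[]. Qed.

Lemma chain_lt_y i j : (i < j <= k)%N -> (v j yvar < v i yvar)%N.
Proof.
move=> /andP[ij jk]; apply: (sorted_ltn_nth _ 0%MM g_desc) => //.
- by move=> b a c ab bc; apply: ltn_trans bc ab.
- by rewrite inE size_tuple; lia.
- by rewrite inE size_tuple.
Qed.

Lemma chain_lt_x i j : (i < j <= k)%N -> (v i xvar < v j xvar)%N.
Proof.
move=> ij; rewrite -mingens_lt ?chain_lt_y //; apply: chain_mingens; lia.
Qed.

Lemma chain_uniq : uniq g.
Proof.
apply: (sorted_uniq _ _ g_desc) => [b a c ab bc|a]; last exact: ltnn.
exact: ltn_trans bc ab.
Qed.

(** Minimizing over the monomials of I can be done within P. *)
Lemma chain_minimizer (a b c d : nat) :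
  let u (m : 'X_{1..2}) := (a * m xvar + b * m yvar)%N in
  let w (m : 'X_{1..2}) := (c * m xvar + d * m yvar)%N in
  (forall m n, u m = u n -> w m = w n -> m = n) ->
  exists2 t, (t <= k)%N & forall m, monomials I m -> (u (v t) <= u m)%N.
Proof.
move=> u w inj.
have [|f /persistent_g /= fg minf] := lex_min_persistent I_mon inj.
  by exists (v 0); apply: mingens_monomials; apply: chain_mingens.
exists (index f g).
  by rewrite -ltnS -[X in (_ < X)%N](size_tuple g) index_mem.
by move=> m /minf; rewrite nth_index.
Qed.

Lemma chain_first m : monomials I m -> (v 0 xvar <= m xvar)%N.
Proof.
move=> Im; have [|t tk mint] := @chain_minimizer 1 0 0 1.
  by move=> *; apply: mnm2_eq; lia.
have := mint m Im; case: t tk {mint} => [|t tk]; first by lia.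
have := @chain_lt_x 0 t.+1; lia.
Qed.

Lemma chain_last m : monomials I m -> (v k yvar <= m yvar)%N.
Proof.
move=> Im; have [|t tk mint] := @chain_minimizer 0 1 1 0.
  by move=> *; apply: mnm2_eq; lia.
have := mint m Im; have [->|tk'] := eqVneq t k; first by lia.
have := @chain_lt_y t k; lia.
Qed.

Lemma chain_chord i m j : (i < m < j)%N -> (j <= k)%N ->
  ((v j xvar - v i xvar) * v m yvar <=
   (v j xvar - v m xvar) * v i yvar + (v m xvar - v i xvar) * v j yvar)%N.
Proof.
move=> imj jk; apply: (weakly_persistent_chord I_mon).
- by apply: g_weakly_persistent; apply: chain_mem; lia.
- by apply: mingens_monomials; apply: chain_mingens; lia.
- by apply: mingens_monomials; apply: chain_mingens; lia.
- by rewrite !chain_lt_x; lia.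
Qed.

(** A single element of P would have both the least x-degree and the least
    y-degree in I, and so generate I. *)
Lemma chain_nontrivial : ~ principal I -> (0 < k)%N.
Proof.
move=> npr; rewrite lt0n; apply/eqP => k0; apply: npr; exists 'X_[v 0].
have -> : [set 'X_[K, v 0]] = [set 'X_[m] | m in [set v 0]].
  by apply/seteqP; split=> [_ ->|_ [_ -> <-]] //; exists (v 0).
rewrite [LHS](monomial_idealE I_mon) -/(monomial_gen _).
apply/seteqP; split; apply: monomial_gen_sub => m.
  move=> Im; exists (v 0) => //; rewrite mnm2_le chain_first //.
  by have := chain_last Im; rewrite (congr1 (fun i => v i) k0).
move=> ->; exists (v 0); last exact: lepm_refl.
by apply: mingens_monomials; apply: chain_mingens.
Qed.

(** Minimize over I the linear form that is constant on the chord of the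
    neighbours of f in P.  The minimum is attained at an element of P, and by
    [chain_chord] these are not strictly below the line of the chord. *)
Lemma above_chord f : mingens I f -> f \notin g ->
  exists2 i, (i < k)%N & [/\ (v i xvar < f xvar < v i.+1 xvar)%N,
    (v i.+1 yvar < f yvar < v i yvar)%N &
    ((v i.+1 xvar - f xvar) * v i yvar + (f xvar - v i xvar) * v i.+1 yvar <=
     (v i.+1 xvar - v i xvar) * f yvar)%N].
Proof.
move=> Gf fg; have If := mingens_monomials Gf.
have f_neq t : (t <= k)%N -> f xvar != v t xvar.
  move=> tk; apply/eqP => e; move/negP: fg; apply.
  have Gt := chain_mingens tk; suff -> : f = v t by apply: chain_mem.
  apply: mnm2_eq => //.
  have := mingens_lt Gf Gt; have := mingens_lt Gt Gf; rewrite e ltnn; lia.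
have fk : (f xvar < v k xvar)%N.
  have Gk := chain_mingens (leqnn k); rewrite -mingens_lt //.
  rewrite ltn_neqAle chain_last // andbT; apply/eqP => e.
  have := mingens_lt Gf Gk; have := mingens_lt Gk Gf; rewrite e ltnn.
  by have := f_neq k (leqnn k); lia.
have [|i ik /andP[li ri]] := @crossing_index (fun t => v t xvar) k (f xvar).
  rewrite (ltnW fk) andbT ltn_neqAle chain_first // andbT eq_sym; exact: f_neq.
have {}ri : (f xvar < v i.+1 xvar)%N by rewrite ltn_neqAle ri f_neq.
have [Gi Gj] := (chain_mingens (ltnW ik), chain_mingens ik).
have li' : (f yvar < v i yvar)%N by rewrite mingens_lt.
have ri' : (v i.+1 yvar < f yvar)%N by rewrite mingens_lt.
exists i => //; split; [by rewrite li|by rewrite li' ri'|].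
rewrite leqNgt; apply/negP => below.
have [|t tk mint] := @chain_minimizer (v i yvar - v i.+1 yvar)
    (v i.+1 xvar - v i xvar) 1 0.
  move=> m n e1 e2; have ex : m xvar = n xvar by lia.
  apply: mnm2_eq => //; apply/eqP; move/eqP: e1; rewrite ex eqn_add2l eqn_mul2l.
  by case/orP => //; lia.
have {mint} := mint f If.
have [ti|[|[e|e]]] : (t < i)%N \/ (i.+1 < t)%N \/ t = i \/ t = i.+1 by lia.
- have := @chain_chord t i i.+1; have := @chain_lt_x t i; nia.
- move=> ti; have := @chain_chord i i.+1 t; have := @chain_lt_x i.+1 t; nia.
- rewrite e; nia.
- rewrite e; nia.
Qed.

Lemma chain_pair_mingens i : (i < k)%N ->
  mingens (monomial_gen (K := K) [set v i; v i.+1]) (v i) /\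
  mingens (monomial_gen (K := K) [set v i; v i.+1]) (v i.+1).
Proof.
move=> ik; have hx := @chain_lt_x i i.+1; have hy := @chain_lt_y i i.+1.
rewrite mingensE; split; (split; first by
    apply/monomial_genX; eexists; [|exact: lepm_refl]; by [left|right]);
  move=> n /monomial_genX[_ [->|->]]; rewrite !mnm2_le => le1 le2;
  apply: mnm2_eq; lia.
Qed.

Let gap := (\max_(i < k) minn (dist xvar (pair_ideal K g i))
                            (dist yvar (pair_ideal K g i)))%N.
Let d := minn (dist xvar I) (dist yvar I).

Lemma nonchain_power f : mingens I f -> f \notin g ->
  exists i a b, [/\ (i < k)%N, (0 < a + b <= gap)%N &
    (v i *+ a + v i.+1 *+ b <= f *+ (a + b))%MM].
Proof.
move=> Gf fg; have [i ik [hx hy above]] := above_chord Gf fg.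
have [w wE] := minn_dist (pair_ideal K g (Ordinal ik)).
have [a [b [[a0 b0 ab] _ _ le]]] := segment_weights w hx hy.
exists i, a, b; split; [by []| |exact: le]; rewrite addn_gt0 a0 /= ab.
have [Gi Gj] := chain_pair_mingens ik.
apply: leq_trans (dist_span w _ Gi Gj) _; first by exists [set v i; v i.+1].
rewrite -/(pair_ideal K g (Ordinal ik)) wE.
exact: (leq_bigmax (F := fun i : 'I_k => minn (dist xvar (pair_ideal K g i))
                            (dist yvar (pair_ideal K g i)))).
Qed.

(** Minimize lexicographically the number of factors outside P and then the
    sum of squares of the coordinate c that realizes the minimum of the two
    distances of I. *)
Lemma reduced_product n m : nfold (mingens I) n m ->
  exists s, [/\ size s = n, forall x, x \in s -> mingens I x,
    (\sum_(x <- s) x <= m)%MM,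
    forall f, mingens I f -> f \notin g -> (count_mem f s < gap)%N &
    forall i j, (i.+1 < j <= k)%N ->
      (count_mem (v i) s < d.-1)%N \/ (count_mem (v j) s < d.-1)%N].
Proof.
move=> [s0 [sz0 Gs0 m0]]; have [c cE] := minn_dist I.
pose u (s : seq 'X_{1..2}) := count [predC g] s.
pose w (s : seq 'X_{1..2}) := (\sum_(x <- s) x c ^ 2)%N.
pose A := [set s : seq 'X_{1..2} | [/\ size s = n,
  forall x, x \in s -> mingens I x & (\sum_(x <- s) x <= m)%MM]].
have [|s [sz Gs sm] mins] := @lex_min _ A u w.
  by exists s0; split=> //; rewrite m0 lepm_refl.
have opt s1 s2 r : perm_eq s (s1 ++ r) -> size s1 = size s2 ->
    (forall x, x \in s2 -> mingens I x) ->
    (\sum_(x <- s2) x <= \sum_(x <- s1) x)%MM ->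
    (u s1 < u s2)%N \/ u s1 = u s2 /\ (w s1 <= w s2)%N.
  move=> ps e12 Gs2 le; have /mins : A (s2 ++ r).
    split.
    - by rewrite -sz (perm_size ps) !size_cat e12.
    - move=> x; rewrite mem_cat => /orP[/Gs2//|xr]; apply: Gs.
      by rewrite (perm_mem ps) mem_cat xr orbT.
    - apply: lepm_trans sm; rewrite (perm_big _ ps) !big_cat /=.
      by apply/mnm_lepP => i; rewrite !mnmDE leq_add2r (mnm_lepP le).
  by rewrite /u /w (permP ps) (perm_big _ ps) !big_cat !count_cat /=; lia.
exists s; split=> // [f Gf fg|i j ij].
(* A power of f could be traded for neighbours in P. *)
- have [i [a [b [ik /andP[ab0 abgap] le]]]] := nonchain_power Gf fg.
  rewrite ltnNge; apply/negP => /(leq_trans abgap)/perm_nseq_count[r pr].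
  have [] := opt _ (nseq a (v i) ++ nseq b (v i.+1)) _ pr.
  + by rewrite size_cat !size_nseq.
  + move=> x; rewrite mem_cat !mem_nseq => /orP[]/andP[_ /eqP->];
      apply: chain_mingens; lia.
  + by rewrite big_cat /= !big_nseq_mnm.
  + rewrite /u count_cat !count_nseq /= fg !chain_mem //; lia.
  + rewrite /u count_cat !count_nseq /= fg !chain_mem //; lia.
(* Copies of [v i] and [v j] could be moved inwards to [v i.+1]; both weights
   are less than [d], as they are positive with sum at most [d]. *)
- have [ci|ci] := ltnP (count_mem (v i) s) d.-1; first by left.
  have [cj|cj] := ltnP (count_mem (v j) s) d.-1; first by right.
  have hx : (v i xvar < v i.+1 xvar < v j xvar)%N by rewrite !chain_lt_x; lia.
  have hy : (v j yvar < v i.+1 yvar < v i yvar)%N by rewrite !chain_lt_y; lia.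
  have [a [b [[a0 b0 ab] e le _]]] := segment_weights c hx hy.
  have Gi : mingens I (v i) by apply: chain_mingens; lia.
  have Gj : mingens I (v j) by apply: chain_mingens; lia.
  have abd : (a + b <= d)%N by rewrite ab /d -cE; apply: dist_span.
  have vij : v i != v j by apply/eqP => vij; rewrite vij in hx; lia.
  have [||r pr] := @perm_nseq_count2 _ a b _ _ s vij; [lia..|].
  have [] := opt _ (nseq (a + b) (v i.+1)) _ pr.
  + by rewrite size_cat !size_nseq.
  + move=> x; rewrite mem_nseq => /andP[_ /eqP ->]; apply: chain_mingens; lia.
  + rewrite big_cat /= !big_nseq_mnm; apply: le; apply: chain_chord; lia.
  + rewrite /u count_cat !count_nseq /= !chain_mem //; lia.
  + have vc : v i c <> v j c by lia.
    have := sum_sqr_lt a0 b0 vc e.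
    rewrite /w big_cat /= !big_nseq !iter_addn_0; lia.
Qed.

(** The factors outside P number at most (mu(I) - |P|) delta_P, and the light
    elements of P account for at most (|P| - 2) d_P more. *)
Lemma consecutive_factors (D l : nat) m : ~ principal I ->
  ((mu I)%:Z - #|` fset_set [set` g]|%:Z) * delta_of K g
    + #|` fset_set [set` g]|%:Z * d_of I [set` g] <= D%:Z ->
  nfold (mingens I) (D + l) m ->
  exists i s, [/\ (i < k)%N, size s = (D + l)%N,
    forall x, x \in s -> mingens I x, (\sum_(x <- s) x <= m)%MM &
    (l <= count_mem (v i) s + count_mem (v i.+1) s)%N].
Proof.
move=> npr; have cardP : #|` fset_set [set` g]| = k.+1.
  rewrite -[RHS](size_tuple g).
  apply/perm_size/uniq_perm => [//||x]; first exact: chain_uniq.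
  rewrite in_fset_set; last exact: (finite_seq g).
  by apply/idP/idP; rewrite inE.
rewrite cardP => D_ge /reduced_product[s [sz Gs sm few light]].
suff [i ik heavy] : exists2 i, (i < k)%N &
    (l <= count_mem (v i) s + count_mem (v i.+1) s)%N by exists i, s.
(* If P has more than two elements, then one lies strictly between the ends
   in both degrees, so that the subtraction in [b] is not truncated. *)
have d_ge2 : (2 <= k)%N -> (2 <= d)%N.
  move=> k2; have G0 := chain_mingens (leq0n k).
  have Gk := chain_mingens (leqnn k).
  have := dist_ge xvar I_mon Gk G0; have := dist_ge yvar I_mon G0 Gk.
  have := @chain_lt_y 0 1; have := @chain_lt_y 1 k.
  have := @chain_lt_x 0 1; have := @chain_lt_x 1 k.
  rewrite /d; lia.
pose b := (if (2 < k.+1)%N then d - 2 else 0)%N.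
have := @heavy_pair k b l (fun i => count_mem (v i) s) (chain_nontrivial npr).
apply; last first.
  move=> i j ij; have k2 : (2 <= k)%N by lia.
  by rewrite /b ltnS k2; have := light i j ij; have := d_ge2 k2; lia.
have sum_g (q : seq 'X_{1..2}) :
    (\sum_(x <- g) count_mem x q = count (mem g) q)%N.
  by apply: sum_count_mem; apply: chain_uniq.
have -> : (\sum_(0 <= i < k.+1) count_mem (v i) s = count (mem g) s)%N.
  rewrite -{1}(size_tuple g) -sum_g.
  by rewrite -(big_nth 0%MM xpredT (fun x => count_mem x s)).
have finG : finite_set (mingens I).
  by rewrite mingens_min //; apply: min_elts_finite.
have inG x : (x \in (fset_set (mingens I) : seq _)) = (x \in mingens I).
  exact: in_fset_set.
pose r := [seq x <- fset_set (mingens I) | x \notin g].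
have szr : (size r + k.+1 = mu I)%N.
  rewrite /mu -(count_predC (mem g) (fset_set _)) addnC size_filter.
  congr (_ + _)%N; rewrite -sum_g -[LHS](size_tuple g) -sum1_size.
  apply: eq_big_seq => x xg.
  rewrite (count_uniq_mem _ (fset_uniq _)) inG mem_set //.
  exact: (g_weakly_persistent xg).1.
have := count_predC (mem g) s; rewrite sz.
have -> : count (predC (mem g)) s = count (mem r) s.
  apply: eq_in_count => x xs /=.
  by rewrite mem_filter inG (mem_set (Gs _ xs)) andbT.
rewrite -(@sum_count_mem _ r) ?filter_uniq ?fset_uniq //.
have few_r : (\sum_(x <- r) count_mem x s)%N%:Z <= (size r)%:Z * (gap%:Z - 1).
  have few' x : x \in r -> (count_mem x s < gap)%N.
    by rewrite mem_filter inG => /andP[xg]; rewrite inE => Gx; apply: few.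
  have : (\sum_(x <- r) count_mem x s <= size r * gap.-1)%N.
    by apply: sum_seq_leq => x /few'; lia.
  have : (size r = 0 \/ 0 < gap)%N.
    case: (r) few' => [|x q] few'; first by left.
    by right; have := few' x (mem_head _ _); lia.
  nia.
have dP : d_of I [set` g] = b%:Z.
  by rewrite /d_of cardP /b ltnS; case: ifP => // /d_ge2 /subzn.
move: D_ge few_r; rewrite -szr /delta_of -/gap dP PoszD addrK.
move: (count (mem g) s) (\sum_(x <- r) _)%N (_ * _ : int) => C E N; lia.
Qed.

End Chain.

Theorem theorem3p16 (K : fieldType) (I : set {mpoly K[2]})
    (I_mon : monomial_ideal I) (I_nonprincipal : ~ principal I)
    (P : set 'X_{1..2})
    (P_ge : persistent I `<=` P) (P_le : P `<=` weakly_persistent I)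
    (k : nat) (g : k.+1.-tuple 'X_{1..2})
    (P_eq : P = [set` g])
    (g_desc : sorted (fun m n : 'X_{1..2} => (n yvar < m yvar)%N) g)
    (D : nat)
    (D_ge : ((mu I)%:Z - #|` fset_set P|%:Z) * delta_of K g
            + #|` fset_set P|%:Z * d_of I P <= D%:Z)
    (l : nat) :
  ideal_exp I (D + l) =
  ideal_sum (fun i : 'I_k =>
    ideal_mul (ideal_exp (pair_ideal K g i) l) (ideal_exp I D)).
Proof.
move: P_ge P_le D_ge; rewrite P_eq => {P P_eq} P_ge P_le D_ge.
set G := mingens I; have IG : I = monomial_gen G.
  exact: monomial_ideal_mingens.
have expE n : ideal_exp I n = monomial_gen (nfold G n).
  by rewrite [in LHS]IG ideal_exp_gen.
pose S (i : 'I_k) := [set (s + t)%MM | s in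
  nfold [set nth 0%MM g i; nth 0%MM g i.+1] l & t in nfold G D].
have -> : (fun i : 'I_k =>
    ideal_mul (ideal_exp (pair_ideal K g i) l) (ideal_exp I D)) =
    fun i => monomial_gen (K := K) (S i).
  by apply/funext => i; rewrite expE /pair_ideal ideal_exp_gen ideal_mul_gen.
rewrite ideal_sum_gen expE; apply/seteqP; split; apply: monomial_gen_sub => m.
  move=> /(consecutive_factors I_mon P_ge P_le g_desc I_nonprincipal D_ge).
  move=> [i [s [ik sz Gs sm]]].
  set p := nth 0%MM g i; set q := nth 0%MM g i.+1 => heavy.
  have pq : p != q.
    apply/eqP => pq; have := @chain_lt_y _ _ g_desc i i.+1.
    rewrite -/p -/q pq; lia.
  pose a := minn l (count_mem p s).
  have [||r pr] := @perm_nseq_count2 _ a (l - a) p q s pq; [lia|lia|].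
  exists (\sum_(x <- nseq a p ++ nseq (l - a) q) x + \sum_(x <- r) x)%MM.
    exists (Ordinal ik) => //.
    exists (\sum_(x <- nseq a p ++ nseq (l - a) q) x)%MM.
      exists (nseq a p ++ nseq (l - a) q); split=> //.
        by rewrite size_cat !size_nseq; lia.
      move=> x; rewrite mem_cat !mem_nseq.
      by move=> /orP[]/andP[_ /eqP->]; [left|right].
    exists (\sum_(x <- r) x)%MM => //; exists r; split=> //.
      have := perm_size pr; rewrite sz !size_cat !size_nseq.
      by rewrite subnKC ?geq_minl // addnC => /addnI ->.
    by move=> x xr; apply: Gs; rewrite (perm_mem pr) mem_cat xr orbT.
  by rewrite -big_cat -(perm_big _ pr).
move=> [i _ [_ [s [sl Ss ->]] [_ [t [tD Gt ->]] <-]]].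
exists (\sum_(x <- s ++ t) x)%MM; last by rewrite big_cat lepm_refl.
exists (s ++ t); split=> //; first by rewrite size_cat sl tD addnC.
move=> x; rewrite mem_cat => /orP[/Ss|/Gt //].
by case: i {Ss} => i ik /=; case=> ->; apply: (chain_mingens P_le); lia.
Qed.
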